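(* (a) The efficiency of the fair allocation under the stable-matching sharing policy is at least $\frac12$ of the maximum efficiency of any feasible allocation. (b) The efficiency of fair allocations under the equal-sharing and the proportional-sharing policies can be arbitrarily far from the optimum: for every $\rho>0$ there are instances on which (even the most efficient) fair allocation under equal sharing, respectively proportional sharing, has efficiency less than $\rho$ times the maximum efficiency of a feasible allocation.
   Context: Display ad instance: a set $I$ of impressions and a set $J$ of advertisers; advertiser $j$ has an integer demand $n(j)$ and each pair has a weight $w_{ij}\ge0$; each advertiser has a preference order on impressions by nonincreasing $w_{ij}$. A feasible allocation assigns each impression to at most one advertiser and at most $n(j)$ impressions to advertiser $j$; efficiency of a (fractional) allocation $x$ is $\sum_{i,j}w_{ij}x_{ij}$. A sharing policy $H$ maps an impression $i$ and the set $J(i)$ of advertisers interested in $i$ to a fractional allocation $\{x_{ij}\}_{j\in J(i)}$ of $i$. Equal sharing: $x_{ij}=1/|J(i)|$. Proportional sharing: $x_{ij}=w_{ij}/\sum_{j'\in J(i)}w_{ij'}$. Stable-matching sharing: $i$ is given entirely to the advertiser in $J(i)$ with largest $w_{ij}$. An allocation $x^*$ is fair under $H$ if each advertiser is interested in a prefix of its preference order, $x^*$ is obtained by applying $H$ to each impression with $J(i)$ the set of advertisers interested in $i$, and each advertiser is either interested in all impressions or receives at least $n(j)$ impressions in total under $x^*$. *)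

(* Defs.v *)
From mathcomp Require Import all_boot all_order all_algebra.
From mathcomp Require Import reals.
Set Implicit Arguments.
Unset Strict Implicit.
Unset Printing Implicit Defensive.
Import Order.TTheory GRing.Theory Num.Theory.
Local Open Scope ring_scope.

(* [pref j] lists every impression exactly once, most preferred first; this
   fixes the way in which advertiser [j] breaks ties between equal weights. *)
Record instance (R : realType) := Instance {
  imp : finType;
  adv : finType;
  demand : adv -> nat;
  weight : imp -> adv -> R;
  pref : adv -> seq imp;
  weight_ge0 : forall i j, 0 <= weight i j;
  pref_perm : forall j, perm_eq (pref j) (enum imp);
  pref_sorted : forall j,
    sorted (fun i i' => weight i' j <= weight i j) (pref j)
}.

Section Allocations.
Variables (R : realType) (A : instance R).

Definition efficiency (x : imp A -> adv A -> R) : R :=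
  \sum_i \sum_j weight i j * x i j.

Definition feasible (f : {ffun imp A -> option (adv A)}) : bool :=
  [forall j, #|[set i | f i == Some j]| <= demand j]%N.

Definition alloc_of (f : {ffun imp A -> option (adv A)}) :
    imp A -> adv A -> R :=
  fun i j => (f i == Some j)%:R.

(* The default value 0 is itself the efficiency of a feasible allocation, the
   one that assigns no impression, so this is a genuine maximum. *)
Definition max_efficiency : R :=
  \big[Num.max/0]_(f : {ffun imp A -> option (adv A)} | feasible f)
     efficiency (alloc_of f).

Record sharing_policy := SharingPolicy {
  share :> imp A -> {set adv A} -> adv A -> R;
  share_ge0 : forall i S j, 0 <= share i S j;
  share_out : forall i (S : {set adv A}) j, j \notin S -> share i S j = 0;
  share_le1 : forall i S, \sum_j share i S j <= 1
}.

Definition equal_sharing (H : sharing_policy) : Prop :=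
  forall i (S : {set adv A}) j, j \in S -> H i S j = 1 / #|S|%:R.

(* The formula is meaningless when all the weights of [S] vanish; the policy
   is left unconstrained in that case. *)
Definition proportional_sharing (H : sharing_policy) : Prop :=
  forall i (S : {set adv A}) j, j \in S -> 0 < \sum_(k in S) weight i k ->
    H i S j = weight i j / \sum_(k in S) weight i k.

(* Any rule may be used to break ties between equal weights. *)
Definition stable_matching_sharing (H : sharing_policy) : Prop :=
  forall i (S : {set adv A}), S != set0 ->
    exists j, [/\ j \in S,
                  forall k, k \in S -> weight i k <= weight i j
                & forall k, H i S k = (k == j)%:R].

Definition interested (P : adv A -> seq (imp A)) (i : imp A) : {set adv A} :=
  [set j | i \in P j].

Definition fair (H : sharing_policy) (x : imp A -> adv A -> R) : Prop :=
  exists P : adv A -> seq (imp A),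
    [/\ forall j, prefix (P j) (pref j),
        forall i j, x i j = H i (interested P i) j
      & forall j, (forall i, i \in P j) \/ (demand j)%:R <= \sum_i x i j].

Lemma equal_sharing_ex : exists H, equal_sharing H.
Proof.
pose h (i : imp A) (S : {set adv A}) j : R :=
  if j \in S then 1 / #|S|%:R else 0.
have h0 i S j : 0 <= h i S j.
  by rewrite /h; case: ifP => // _; rewrite divr_ge0 ?ler0n.
have ho i (S : {set adv A}) j : j \notin S -> h i S j = 0 by rewrite /h => /negbTE ->.
have h1 i S : \sum_j h i S j <= 1.
  rewrite /h -big_mkcond sumr_const -[leLHS]mulr_natl mul1r.
  have [->|nz] := eqVneq (#|S|%:R : R) 0; first by rewrite mul0r; exact: ler01.
  by rewrite mulfV.
by exists (SharingPolicy h0 ho h1) => i S j jS; rewrite /= /h jS.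
Qed.

Lemma proportional_sharing_ex : exists H, proportional_sharing H.
Proof.
pose h (i : imp A) (S : {set adv A}) j : R :=
  if j \in S then weight i j / \sum_(k in S) weight i k else 0.
have h0 i S j : 0 <= h i S j.
  rewrite /h; case: ifP => // _; rewrite divr_ge0 ?weight_ge0 ?sumr_ge0 //.
  by move=> k _; exact: weight_ge0.
have ho i (S : {set adv A}) j : j \notin S -> h i S j = 0 by rewrite /h => /negbTE ->.
have h1 i S : \sum_j h i S j <= 1.
  rewrite /h -big_mkcond -mulr_suml.
  have [->|nz] := eqVneq (\sum_(k in S) weight i k) 0.
    by rewrite mul0r; exact: ler01.
  by rewrite mulfV.
by exists (SharingPolicy h0 ho h1) => i S j jS _; rewrite /= /h jS.
Qed.

Lemma stable_matching_sharing_ex : exists H, stable_matching_sharing H.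
Proof.
pose best i (S : {set adv A}) :=
  [pick j in S | [forall k in S, weight i k <= weight i j]].
pose h (i : imp A) (S : {set adv A}) j : R := (best i S == Some j)%:R.
have h0 i S j : 0 <= h i S j by rewrite /h ler0n.
have ho i (S : {set adv A}) j : j \notin S -> h i S j = 0.
  rewrite /h /best; case: pickP => [k /andP[kS _]|//] jS.
  by case: eqP => // -[kj]; rewrite -kj kS in jS.
have h1 i S : \sum_j h i S j <= 1.
  rewrite /h; case: (best i S) => [b|]; last by rewrite big1 /= ?ler01.
  rewrite (bigD1 b) //= eqxx big1 ?addr0 // => k kb.
  by case: eqP => // -[bk]; rewrite bk eqxx in kb.
exists (SharingPolicy h0 ho h1) => i S /set0Pn[j0 j0S] /=.
rewrite /h /best; case: pickP => [b /andP[bS /forall_inP bmax]|nomax].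
  by exists b; split=> // k; rewrite (inj_eq (@Some_inj _)) eq_sym.
case: (Order.TotalTheory.arg_maxP (fun j => weight i j) j0S) => b bS bmax.
by have /negP[] := negbT (nomax b); apply/andP; split=> //; apply/forall_inP.
Qed.

End Allocations.

(* Main.v *)
Require Import Defs.
From mathcomp Require Import all_boot all_order all_algebra.
From mathcomp Require Import reals.
Import Order.TTheory GRing.Theory Num.Theory.
Local Open Scope ring_scope.

(** Stable matching.  Split the value of a feasible allocation [f] according to
    whether the advertiser [j] receiving [i] is interested in [i] in the fair
    allocation [x].  If so, [i] goes in [x] to an advertiser with at least the
    weight of [j], so these impressions contribute at most the value of [x].
    If not, [j] receives at least [n(j)] impressions in [x], each of them at
    least as valuable to [j] as any impression outside its prefix, so these
    impressions also contribute at most the value of [x].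

    Equal and proportional sharing.  With a single impression and unit demands,
    every advertiser must be interested in it.  One advertiser of weight [1]
    then loses almost everything to a crowd of [k] advertisers of weight [e]:
    take [e = 0] and [k] large for equal sharing, and [e = 1/m], [k = m^2] for
    proportional sharing, where the efficiency is [2 / (1 + m)]. *)

(** * Fair allocations and the bound for stable matching *)

Section Fairness.
Variables (R : realType) (A : instance R) (H : sharing_policy A).

(** Taking every prefix to be the whole preference list makes each advertiser interested in all
    impressions. *)
Lemma fair_exists : exists x : imp A -> adv A -> R, fair H x.
Proof.
exists (fun i j => H i (interested (@pref R A) i) j), (@pref R A).
split=> // j; first exact: prefix_refl.
by left=> i; rewrite (perm_mem (pref_perm j)) mem_enum.
Qed.

Lemma weight_prefix_le (s : seq (imp A)) i i' j :
  prefix s (pref j) -> i \in s -> i' \notin s -> weight i' j <= weight i j.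
Proof.
move=> /prefixP[t pref_cat] i_s i'_s.
have i'_t : i' \in t.
  have : i' \in pref j by rewrite (perm_mem (pref_perm j)) mem_enum.
  by rewrite pref_cat mem_cat (negbTE i'_s).
have := pref_sorted j; rewrite pref_cat sorted_pairwise; last first.
  by move=> y x z le_yx le_zy; exact: le_trans le_zy le_yx.
by rewrite pairwise_cat => /andP[/allrelP le_ts _]; exact: le_ts.
Qed.

Lemma efficiency_ge0 (x : imp A -> adv A -> R) :
  (forall i j, 0 <= x i j) -> 0 <= efficiency x.
Proof.
by move=> x0; apply: sumr_ge0 => i _; apply: sumr_ge0 => j _;
  rewrite mulr_ge0 ?weight_ge0.
Qed.

Lemma le_max_efficiency (f : {ffun imp A -> option (adv A)}) :
  feasible f -> efficiency (alloc_of f) <= max_efficiency A.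
Proof. by move=> f_feas; rewrite /max_efficiency; exact: le_bigmax_cond. Qed.

Section StableMatching.
Variables (x : imp A -> adv A -> R) (P : adv A -> seq (imp A)).
Hypothesis H_stable : stable_matching_sharing H.
Hypothesis P_prefix : forall j, prefix (P j) (pref j).
Hypothesis x_share : forall i j, x i j = H i (interested P i) j.
Hypothesis P_sated :
  forall j, (forall i, i \in P j) \/ (demand j)%:R <= \sum_i x i j.
Variable f : {ffun imp A -> option (adv A)}.
Hypothesis f_feasible : feasible f.

Let x_ge0 i j : 0 <= x i j.
Proof. by rewrite x_share share_ge0. Qed.

Lemma interested_value_le i :
  \sum_(j | i \in P j) weight i j * alloc_of f i j
    <= \sum_j weight i j * x i j.
Proof.
have rhs0 : 0 <= \sum_j weight i j * x i j.
  by apply: sumr_ge0 => j _; rewrite mulr_ge0 ?weight_ge0.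
rewrite /alloc_of; case fi: (f i) => [j0|]; last first.
  by rewrite big1 // => j _; rewrite mulr0.
have [i_j0|i_j0] := boolP (i \in P j0); last first.
  rewrite big1 // => j i_j; case: eqP => [[j0j]|_]; last by rewrite mulr0.
  by rewrite j0j i_j in i_j0.
rewrite (bigD1 j0) //= eqxx mulr1 big1 ?addr0; last first.
  move=> j /andP[_ jj0]; case: eqP => [[j0j]|_]; last by rewrite mulr0.
  by rewrite j0j eqxx in jj0.
have j0_int : j0 \in interested P i by rewrite inE.
have [|b [_ b_max b_share]] := H_stable i (interested P i).
  by apply/set0Pn; exists j0.
rewrite (bigD1 b) //= x_share b_share eqxx mulr1 -[leLHS]addr0 lerD ?b_max //.
by apply: sumr_ge0 => j _; rewrite mulr_ge0 ?weight_ge0.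
Qed.

Lemma uninterested_value_le j :
  \sum_(i | i \notin P j) weight i j * alloc_of f i j
    <= \sum_i weight i j * x i j.
Proof.
have rhs0 : 0 <= \sum_i weight i j * x i j.
  by apply: sumr_ge0 => i _; rewrite mulr_ge0 ?weight_ge0.
have [allP|dem_le] := P_sated j; first by rewrite big1 // => i; rewrite allP.
(* The threshold [t] separates the weights outside the prefix from those inside. The default 0 is
   harmless because weights are nonnegative. *)
pose t : R := \big[Num.max/0]_(i | i \notin P j) weight i j.
have t0 : 0 <= t by exact: bigmax_ge_id.
have t_ge i : i \notin P j -> weight i j <= t.
  by move=> iP; rewrite /t; exact: (le_bigmax_cond 0 (fun i => weight i j)).
have t_le i : i \in P j -> t <= weight i j.
  move=> iP; apply: bigmax_le => [|i' i'P]; first exact: weight_ge0.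
  exact: weight_prefix_le iP i'P.
(* Each impression that [f] gives to [j] is charged [t]. There are at most [demand j] of them, and
   [x] gives [j] at least that total amount, all of it on impressions worth at least [t]. *)
apply: (@le_trans _ _ (\sum_i alloc_of f i j * t)).
  rewrite big_mkcond /=; apply: ler_sum => i _.
  by case: ifP => iP; rewrite ?mulr_ge0 ?ler0n // mulrC ler_wpM2l ?ler0n ?t_ge.
apply: (@le_trans _ _ ((demand j)%:R * t)).
  rewrite -mulr_suml ler_wpM2r // -natr_sum ler_nat.
  have := forallP f_feasible j; rewrite -sum1dep_card big_mkcond /=.
  by apply: leq_trans; apply: leq_sum => i _; case: eqP.
apply: (le_trans (ler_wpM2r t0 dem_le)); rewrite mulr_suml.
apply: ler_sum => i _; have [iP|iP] := boolP (i \in P j).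
  by rewrite mulrC ler_wpM2r ?t_le.
by rewrite x_share share_out ?inE // mulr0 mul0r.
Qed.

Lemma efficiency_le_double :
  efficiency (alloc_of f) <= efficiency x + efficiency x.
Proof.
have -> : efficiency (alloc_of f)
    = \sum_i \sum_(j | i \in P j) weight i j * alloc_of f i j
    + \sum_j \sum_(i | i \notin P j) weight i j * alloc_of f i j.
  (* The interested pairs are compared impression by impression and the others advertiser by
     advertiser, hence the opposite orders of summation. *)
  rewrite [X in _ + X](exchange_big_dep predT) //= -big_split /=.
  by apply: eq_bigr => i _; rewrite (bigID (fun j => i \in P j)).
apply: lerD; first by apply: ler_sum => i _; exact: interested_value_le.
rewrite /efficiency [leRHS]exchange_big /=.
by apply: ler_sum => j _; exact: uninterested_value_le.
Qed.

End StableMatching.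

Lemma stable_matching_half (x : imp A -> adv A -> R) :
  stable_matching_sharing H -> fair H x ->
  2^-1 * max_efficiency A <= efficiency x.
Proof.
move=> H_stable [P [P_prefix x_share P_sated]].
rewrite ler_pdivrMl ?ltr0n // mulr2n mulrDl mul1r.
have x0 i j : 0 <= x i j by rewrite x_share share_ge0.
apply: bigmax_le => [|f f_feas]; first by rewrite addr_ge0 ?efficiency_ge0.
exact: efficiency_le_double f_feas.
Qed.

End Fairness.

Lemma sum_unit (V : nmodType) (F : unit -> V) : \sum_i F i = F tt.
Proof. by rewrite (big_pred1 tt) // => -[]. Qed.

(** * Instances with a single impression *)

Section SingleImpression.
Variables (R : realType) (J : finType) (w : J -> R).
Hypothesis w_ge0 : forall j, 0 <= w j.

Lemma enum_sorted_unit (j : J) :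
  sorted (fun i i' : unit => w j <= w j) (enum {: unit}).
Proof.
by case: (enum _) => //= i s; elim: s i => //= i' s IHs i; rewrite IHs lexx.
Qed.

Definition single_impression : instance R :=
  @Instance R unit J (fun=> 1%N) (fun=> w) (fun=> enum {: unit})
    (fun=> w_ge0) (fun=> perm_refl _) enum_sorted_unit.

(** An advertiser not interested in the only impression would receive 0, below its demand 1. So all
    are interested, and the policy determines the allocation. *)
Lemma single_impression_fair (H : sharing_policy single_impression) x :
  fair H x -> efficiency x = \sum_j w j * H tt setT j.
Proof.
move=> [P [_ x_share P_sated]].
have P_tt j : tt \in P j.
  have [//|] := P_sated j; rewrite sum_unit x_share; apply: contraTT => ttP.
  by rewrite share_out ?inE // -ltNge ltr01.
rewrite /efficiency sum_unit /=.
apply: eq_bigr => j _; rewrite x_share; congr (_ * H _ _ _).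
by apply/setP => k; rewrite !inE P_tt.
Qed.

Lemma single_impression_max j : w j <= max_efficiency single_impression.
Proof.
pose f : {ffun imp single_impression -> option (adv single_impression)} :=
  [ffun=> Some j].
have f_feas : feasible f.
  by apply/forallP => k; rewrite (leq_trans (max_card _)) ?card_unit.
apply: le_trans (le_max_efficiency R single_impression f f_feas).
rewrite /efficiency sum_unit /=.
rewrite (bigD1 j) //= /alloc_of ffunE eqxx mulr1 lerDl.
by apply: sumr_ge0 => k _; rewrite mulr_ge0 ?ler0n.
Qed.

End SingleImpression.

(** * One advertiser of weight 1 against [k] of weight [e] *)

Section Crowd.
Variables (R : realType) (k : nat) (e : R).
Hypothesis e_ge0 : 0 <= e.

Definition crowd_weight (j : 'I_k.+1) : R := if j == ord0 then 1 else e.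

Lemma crowd_weight_ge0 j : 0 <= crowd_weight j.
Proof. by rewrite /crowd_weight; case: ifP. Qed.

Definition crowd := single_impression R _ crowd_weight crowd_weight_ge0.

Lemma crowd_max : 1 <= max_efficiency crowd.
Proof. exact: (single_impression_max _ _ _ crowd_weight_ge0 ord0). Qed.

Lemma crowd_sum (g : R -> R) :
  \sum_j g (crowd_weight j) = g 1 + g e *+ k.
Proof.
by rewrite big_ord_recl (eq_bigr (fun=> g e)) // sumr_const card_ord.
Qed.

Lemma crowd_equal (H : sharing_policy crowd) x :
  equal_sharing H -> fair H x ->
  efficiency x = (1 + e *+ k) / k.+1%:R.
Proof.
move=> H_eq /single_impression_fair ->.
rewrite -(crowd_sum id) mulr_suml; apply: eq_bigr => j _.
by rewrite H_eq ?inE // cardsT card_ord mul1r.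
Qed.

Lemma crowd_proportional (H : sharing_policy crowd) x :
  proportional_sharing H -> fair H x ->
  efficiency x = (1 + e ^+ 2 *+ k) / (1 + e *+ k).
Proof.
move=> H_prop /single_impression_fair ->.
have total : \sum_(j in [set: 'I_k.+1]) crowd_weight j = 1 + e *+ k.
  by rewrite -(crowd_sum id); apply: eq_bigl => j; rewrite inE.
(* A share proportional to the weight earns that weight squared over the total. *)
have -> : 1 + e ^+ 2 *+ k = \sum_j crowd_weight j ^+ 2.
  by rewrite (crowd_sum (fun y => y ^+ 2)) expr1n.
rewrite mulr_suml; apply: eq_bigr => j _.
rewrite H_prop ?inE //= total ?expr2 ?mulrA //.
by rewrite ltr_pwDl ?mulrn_wge0.
Qed.

End Crowd.

Lemma equal_sharing_unbounded (R : realType) (rho : R) : 0 < rho ->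
  exists A : instance R, forall (H : sharing_policy A) x,
    equal_sharing H -> fair H x -> efficiency x < rho * max_efficiency A.
Proof.
move=> rho0; pose k := Num.bound rho^-1.
exists (crowd R k 0 (lexx 0)) => H x H_eq x_fair.
(* Since the optimum is at least 1, an efficiency below [rho] suffices; here it is [1 / (k + 1)]. *)
apply: lt_le_trans (ler_peMr (ltW rho0) (crowd_max R k 0 (lexx 0))).
rewrite (crowd_equal _ _ _ _ _ _ H_eq x_fair) mul0rn addr0 mul1r.
rewrite invf_plt ?posrE ?ltr0n //.
apply: lt_trans (archi_boundP _) _; first by rewrite invr_ge0 ltW.
by rewrite ltr_nat.
Qed.

Lemma proportional_sharing_unbounded (R : realType) (rho : R) : 0 < rho ->
  exists A : instance R, forall (H : sharing_policy A) x,
    proportional_sharing H -> fair H x ->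
    efficiency x < rho * max_efficiency A.
Proof.
(* This gives [2 / rho < 1 + m]; the successor keeps [m] nonzero, so that [e = 1 / m] can be
   inverted. *)
move=> rho0; pose m := (Num.bound (2 / rho)).+1.
have quot_ge0 : 0 <= 2 / rho by rewrite divr_ge0 ?ler0n ?ltW.
have m0 : m%:R != 0 :> R by rewrite pnatr_eq0.
have e0 : 0 <= m%:R^-1 :> R by rewrite invr_ge0 ler0n.
exists (crowd R (m ^ 2) m%:R^-1 e0) => H x H_prop x_fair.
apply: lt_le_trans (ler_peMr (ltW rho0) (crowd_max R _ _ e0)).
rewrite (crowd_proportional _ _ _ _ _ _ H_prop x_fair).
(* With [k = m ^ 2], the crowd's squared weights add up to 1 and its weights to [m]. *)
rewrite -[_ ^+ 2 *+ _]mulr_natr -[_^-1 *+ _]mulr_natr natrX -exprMn mulVf //.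
rewrite expr1n expr2 mulKf // ltr_pdivrMr ?ltr_pwDl //.
rewrite mulrC -ltr_pdivrMr //.
apply: lt_trans (archi_boundP quot_ge0) _.
by rewrite nat1r ltr_nat leqW.
Qed.

Theorem theorem12 (R : realType) :
  (forall (A : instance R) (H : sharing_policy A),
     stable_matching_sharing H ->
     (exists x : imp A -> adv A -> R, fair H x) /\
     (forall x : imp A -> adv A -> R, fair H x ->
        2^-1 * max_efficiency A <= efficiency x))
  /\
  (forall rho : R, 0 < rho ->
     (exists A : instance R, forall H : sharing_policy A,
        equal_sharing H ->
        (exists x : imp A -> adv A -> R, fair H x) /\
        (forall x : imp A -> adv A -> R, fair H x ->
           efficiency x < rho * max_efficiency A))
     /\
     (exists A : instance R, forall H : sharing_policy A,
        proportional_sharing H ->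
        (exists x : imp A -> adv A -> R, fair H x) /\
        (forall x : imp A -> adv A -> R, fair H x ->
           efficiency x < rho * max_efficiency A))).
Proof.
split=> [A H H_stable|rho rho0].
  by split=> [|x]; [exact: fair_exists | exact: stable_matching_half].
split.
  have [A A_bad] := equal_sharing_unbounded R rho rho0.
  by exists A => H H_eq; split=> [|x]; [exact: fair_exists | exact: A_bad].
have [A A_bad] := proportional_sharing_unbounded R rho rho0.
by exists A => H H_prop; split=> [|x]; [exact: fair_exists | exact: A_bad].
Qed.
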